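(* Every generalized bitopological space $(X,\mu_1,\mu_2)$ that is pairwise $T_1$ and pairwise $\lambda$-symmetric is pairwise $T_{\frac12}$.
   Context: A generalized topology on a nonempty set $X$ is a collection $\mu$ of subsets of $X$ that contains $\emptyset$ and is closed under arbitrary unions ($X$ itself need not belong to $\mu$). Members of $\mu$ are called $\mu$-open and their complements $\mu$-closed. The $\mu$-closure $\overline{A_{\mu}}$ of $A$ is the intersection of all $\mu$-closed sets containing $A$. A generalized bitopological space (GBT-space) $(X,\mu_1,\mu_2)$ is a nonempty set $X$ with two generalized topologies $\mu_1,\mu_2$. Pairwise $T_1$: for any $x,y\in X$ with $x\neq y$ there exist $U\in\mu_1$ and $V\in\mu_2$ such that $x\in U$, $y\notin U$, $y\in V$, $x\notin V$. For $i\neq j$ in $\{1,2\}$, $A\subset X$ is $g_{\mu_i}$-closed with respect to $\mu_j$ if $\overline{A_{\mu_i}}\subset U$ for every $\mu_j$-open set $U\supset A$. Pairwise $T_{\frac12}$: for all $i\neq j$ in $\{1,2\}$ every set that is $g_{\mu_i}$-closed with respect to $\mu_j$ is $\mu_i$-closed. For $A\subset X$, $A_{\mu}^{\wedge}=\bigcap\{U\in\mu: A\subset U\}$ (equal to $X$ if no $\mu$-open set contains $A$); $A$ is a $\wedge_{\mu}$-set if $A=A_{\mu}^{\wedge}$. For $i\neq j$, $A$ is $\lambda_{\mu_i}$-closed with respect to $\mu_j$ if $A=F_i\cap L_j$ with $F_i$ a $\mu_i$-closed set and $L_j$ a $\wedge_{\mu_j}$-set. $A$ is pairwise $\lambda$-closed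 if $A=(F_1\cap F_2)\cap(L_1\cap L_2)$ where $F_1,F_2$ are respectively $\mu_1$-closed and $\mu_2$-closed and $L_1,L_2$ are respectively a $\wedge_{\mu_1}$-set and a $\wedge_{\mu_2}$-set. The space is pairwise $\lambda$-symmetric if every pairwise $\lambda$-closed set is both $\lambda_{\mu_1}$-closed with respect to $\mu_2$ and $\lambda_{\mu_2}$-closed with respect to $\mu_1$. *)

(* Defs.v *)
From mathcomp Require Import all_boot boolp classical_sets.

Set Implicit Arguments.
Unset Strict Implicit.
Unset Printing Implicit Defensive.

Local Open Scope classical_set_scope.

Section GeneralizedTopology.
Variable X : Type.
Implicit Types (mu : set (set X)) (A : set X).

(* The whole space is not required to belong to mu. *)
Definition generalized_topology mu : Prop :=
  mu set0 /\ forall F : set (set X), F `<=` mu -> mu (\bigcup_(U in F) U).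

Definition gclosed mu : set (set X) := [set F | mu (~` F)].

(* smallest C A is the intersection of all members of C that contain A. *)
Definition gclosure mu A : set X := smallest (gclosed mu) A.

(* The intersection of all mu-open supersets of A; it is setT if there are
   none. *)
Definition wedge mu A : set X := smallest mu A.

Definition wedge_set mu A : Prop := A = wedge mu A.

End GeneralizedTopology.

Section GeneralizedBitopology.
Variable X : Type.
Implicit Types (mu : set (set X)) (A : set X).

Definition gbt_space mu1 mu2 : Prop :=
  [/\ [set: X] !=set0, generalized_topology mu1 & generalized_topology mu2].

Definition pairwise_T1 mu1 mu2 : Prop :=
  forall x y : X, x <> y ->
    exists U V : set X, [/\ mu1 U, mu2 V, U x /\ ~ U y & V y /\ ~ V x].

(* In the notions "w.r.t.", mui plays the role of mu_i and muj that of mu_j. *)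
Definition g_closed_wrt mui muj A : Prop :=
  forall U : set X, muj U -> A `<=` U -> gclosure mui A `<=` U.

Definition pairwise_T_half mu1 mu2 : Prop :=
  (forall A, g_closed_wrt mu1 mu2 A -> gclosed mu1 A) /\
  (forall A, g_closed_wrt mu2 mu1 A -> gclosed mu2 A).

Definition lambda_closed_wrt mui muj A : Prop :=
  exists F L : set X, [/\ gclosed mui F, wedge_set muj L & A = F `&` L].

Definition pairwise_lambda_closed mu1 mu2 A : Prop :=
  exists F1 F2 L1 L2 : set X,
    [/\ gclosed mu1 F1 /\ gclosed mu2 F2, wedge_set mu1 L1 /\ wedge_set mu2 L2
      & A = (F1 `&` F2) `&` (L1 `&` L2)].

Definition pairwise_lambda_symmetric mu1 mu2 : Prop :=
  forall A, pairwise_lambda_closed mu1 mu2 A ->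
    lambda_closed_wrt mu1 mu2 A /\ lambda_closed_wrt mu2 mu1 A.

End GeneralizedBitopology.

(* Main.v *)
(* In a pairwise T_1 space every complement of a point is open in both
   topologies.  If A is g-closed, then testing it against the open sets
   X \ {x}, x not in A, shows that its closure adds no point to A. *)
Require Import Defs.
From mathcomp Require Import all_boot boolp classical_sets.

Local Open Scope classical_set_scope.

(** Such an [A] is the union of all the members of [mu] that it contains, and [mu] is closed under
    arbitrary unions. *)
Lemma gt_open_local (X : Type) (mu : set (set X)) (A : set X) :
  generalized_topology mu ->
  (forall x, A x -> exists U, [/\ mu U, U x & U `<=` A]) -> mu A.
Proof.
move=> [_ muU] locA.
have -> : A = \bigcup_(U in [set U | mu U /\ U `<=` A]) U.
  apply/seteqP; split=> [x /locA [U [oU Ux sUA]]|x [U [_ sUA] Ux]].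
    by exists U.
  exact: sUA.
by apply: muU => U [].
Qed.

Lemma g_closed_wrt_gclosed (X : Type) (mui muj : set (set X)) (A : set X) :
  generalized_topology mui -> (forall x, muj (~` [set x])) ->
  g_closed_wrt mui muj A -> gclosed mui A.
Proof.
move=> gti open_setC1 gA; apply: (gt_open_local _ mui) => // x nAx.
have clAx : ~ gclosure mui A x.
  move=> /(gA _ (open_setC1 x)) nxx; apply: nxx => // y Ay yx.
  by apply: nAx; rewrite -yx.
(* The closure is an intersection, so a point outside it is missed by a single closed superset [C]
   of [A]; the complement of [C] is then the open neighbourhood of [x] inside the complement of
   [A]. *)
have [C [cC sAC] nCx] : exists2 C, gclosed mui C /\ A `<=` C & ~ C x.
  apply: contrapT => noC; apply: clAx => C cAC.
  by apply: contrapT => nCx; apply: noC; exists C.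
by exists (~` C); split=> //; apply: subsetC.
Qed.

Lemma pairwise_T1_setC1 (X : Type) (mu1 mu2 : set (set X)) (x : X) :
  gbt_space mu1 mu2 -> pairwise_T1 mu1 mu2 ->
  mu1 (~` [set x]) /\ mu2 (~` [set x]).
Proof.
move=> [_ gt1 gt2] T1; split; apply: gt_open_local => // y yx.
  have [U [_ [oU _ [Uy nUx] _]]] := T1 y x yx.
  by exists U; split=> // z Uz zx; apply: nUx; rewrite -zx.
(* The [mu2]-open set given by [T1] contains the second point, so [x] and [y] are swapped here. *)
have [_ [V [_ oV _ [Vy nVx]]]] := T1 x y (nesym yx).
by exists V; split=> // z Vz zx; apply: nVx; rewrite -zx.
Qed.

Theorem theorem4p5 (X : Type) (mu1 mu2 : set (set X)) :
  gbt_space mu1 mu2 ->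
  pairwise_T1 mu1 mu2 ->
  pairwise_lambda_symmetric mu1 mu2 ->
  pairwise_T_half mu1 mu2.
Proof.
move=> gbt T1 _; have [_ gt1 gt2] := gbt.
have open_setC1 x := pairwise_T1_setC1 _ _ _ x gbt T1.
by split=> A; apply: g_closed_wrt_gclosed => // x; have [] := open_setC1 x.
Qed.
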